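(* Let $q \in \{2,3\}$, let $\sigma_2 = 2$ and $\sigma_3 = C_0$ (the constant described in the context). For any integers $t \geq s \geq 2$, \[R_q(s,t) \leq \tau_s(2t),\] where $\tau_1(x) = x$ and $\tau_{j+1}(x) = \sigma_q^{\tau_j(x)}$ for $j \geq 1$ (i.e., $\tau_s(2t)$ is a tower $\sigma_q^{\sigma_q^{\cdot^{\cdot^{\sigma_q^{2t}}}}}$ of height $s$, counting the top entry $2t$ as one level).
   Context: For a finite field $\mathbb F_q$ and positive integers $s,t$, $R_q(s,t)$ denotes the minimum $n$ such that for every red-blue coloring of the $1$-dimensional linear subspaces of $\mathbb F_q^n$, there is either a linear subspace of dimension $s$ all of whose $1$-dimensional subspaces are red, or a linear subspace of dimension $t$ all of whose $1$-dimensional subspaces are blue. The constant $C_0 \approx 13.901$ is the absolute constant $C_0 = 1 + 1/(1-\log_3 \gamma)$ with $\gamma = \min_{0<x<1}(1+x+x^2)/x^{2/3} \approx 2.7552$ (the constant of Fox–Pham's theorem); it has the known property that every $A \subseteq \mathbb F_3^n$ with $|A| = \alpha 3^n$ contains at least $\alpha^{C_0} 3^{2n}$ triples of the form $(x, x+d, x+2d)$ with $x,d \in \mathbb F_3^n$. *)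

(* Defs.v *)
From HB Require Import structures.
From mathcomp Require Import all_boot all_order all_algebra.
From mathcomp Require Import all_classical all_reals all_analysis.
Set Implicit Arguments. Unset Strict Implicit. Unset Printing Implicit Defensive.
Import Order.TTheory GRing.Theory Num.Theory.
Local Open Scope ring_scope.
Local Open Scope classical_set_scope.

(* Subspaces of F^n are represented by (row spaces of) matrices; a
   1-dimensional subspace (line) spanned by a nonzero row vector v is
   represented canonically by the square matrix <<v>>%MS.  A red/blue colouring
   of the lines is a function [col : 'M[F]_n -> bool] (true = red, false = blue);
   only its values at the canonical representatives <<v>>%MS of lines matter. *)

Definition mono_subspace (F : fieldType) (n m : nat) (col : 'M[F]_n -> bool)
    (b : bool) (U : 'M[F]_(m, n)) : Prop :=
  forall v : 'rV[F]_n, v != 0 -> (v <= U)%MS -> col (<<v>>%MS) = b.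

Definition vramsey_prop (F : fieldType) (s t n : nat) : Prop :=
  forall col : 'M[F]_n -> bool,
    (exists U : 'M[F]_n, \rank U = s /\ mono_subspace col true U) \/
    (exists U : 'M[F]_n, \rank U = t /\ mono_subspace col false U).

(* R_q(s,t) <= x  (R_q(s,t) is the least admissible n) *)
Definition vramsey_le (F : fieldType) (s t : nat) (R : realType) (x : R) : Prop :=
  exists n : nat, (n%:R <= x) /\ vramsey_prop F s t n.

Definition gamma0 (R : realType) : R :=
  inf [set (1 + x + x ^+ 2) / (x `^ (2 / 3)) | x in `]0, 1[%classic].

Definition C0 (R : realType) : R :=
  1 + 1 / (1 - ln (gamma0 R) / ln 3).

Definition sigmaq (R : realType) (q : nat) : R := if q == 2%N then 2 else C0 R.

(* tower k sig x = tau_{k+1}(x): tau_1(x) = x, tau_{j+1}(x) = sig^(tau_j(x)) *)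
Fixpoint tower (R : realType) (k : nat) (sig x : R) : R :=
  match k with
  | 0 => x
  | k'.+1 => sig `^ (tower k' sig x)
  end.

(* Main.v *)
Require Import Defs.
From HB Require Import structures.
From mathcomp Require Import all_boot all_order all_algebra.
From mathcomp Require Import all_classical all_reals all_analysis.
From mathcomp Require Import mxabelem zify ring lra.
Import Order.TTheory GRing.Theory Num.Theory.
Set Implicit Arguments. Unset Strict Implicit. Unset Printing Implicit Defensive.
Local Open Scope ring_scope.

(** Write [C = sigmaq R q].  If a set of density [q^-b] in [F_q^n] contains at
    least a [q^-(C b + K)] proportion of all pairs (point, direction) whose line
    lies in the set, then some direction outside any prescribed small subspace
    is good for a [q^-(C b + K + 1)] proportion of the base points.  The base
    points of a fixed direction form a set invariant under that direction, so
    iterating [d] times gives an affine subspace of dimension [d] in every set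
    of density [q^-t] as soon as [n] is about [C^d t].  If there is no blue
    [t]-subspace, a greedy extension argument shows that the red vectors have
    density at least [q^-t]; they hence contain some [x + V] with
    [dim V = d >= R_q(s,t)].  A red [s]-subspace of [V] together with [x] spans
    a red [(s+1)]-subspace, so [R_q(s+1,t)] is at most about [C^R_q(s,t) t],
    and the [t] of slack in [R_q(1,t) = t <= 2t - t] absorbs the lower-order
    terms at each step.

    For [q = 2] the supersaturation count is exactly the square of the density.
    For [q = 3], a cap set in [F_3^m] has at most [3 gamma^m] points (slice
    rank).  Pulling [A] back along a random affine map [F_3^m -> F_3^n] and
    deleting a point from each line gives
    [alpha 3^m <= 3 gamma^m + 9^m tau] for every [m], where [tau] is the density
    of lines; choosing [m] optimally yields [tau >= 3^-(2 C0) alpha^C0]. *)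

(** * Cap sets in [F_3^m] *)

(** [\rank K] independent columns of a basis form an invertible block, so the values on those
    coordinates can be prescribed. *)
Lemma row_base_unit_coords (F : fieldType) (p a : nat) (K : 'M[F]_(p, a)) :
  exists (f : 'I_(\rank K) -> 'I_a) (phi : 'rV[F]_a),
    [/\ injective f, (phi <= K)%MS & forall i, phi 0 (f i) = 1].
Proof.
have r' : row_full (row_base K)^T by rewrite /row_full mxrank_tr eq_row_base.
have fu := fullrowsub_unit r'.
set B := rowsub _ _ in fu.
pose one : 'rV[F]_(\rank K) := const_mx 1.
exists (fullrankfun r'), (one *m invmx B^T *m row_base K); split.
- exact: fullrankfun_inj.
- by rewrite (submx_trans (submxMl _ _)) // eq_row_base.
- move=> i.
  have -> : (one *m invmx B^T *m row_base K) 0 (fullrankfun r' i)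
      = (one *m invmx B^T *m B^T) 0 i.
    rewrite [LHS]mxE [RHS]mxE; apply: eq_bigr => j _; congr (_ * _).
    by rewrite !mxE.
  by rewrite mulmxKV ?unitmx_tr // mxE.
Qed.

Definition monomial (m : nat) (x : 'rV['F_3]_m) (e : {ffun 'I_m -> 'I_3}) : 'F_3 :=
  \prod_i x 0 i ^+ e i.

Definition low_exponents (m : nat) : {set {ffun 'I_m -> 'I_3}} :=
  finset (fun e : {ffun 'I_m -> 'I_3} => 3 * (\sum_i e i) <= 2 * m)%N.

Definition exp3 := ('I_3 * 'I_3 * 'I_3)%type.

(** In degree two this is minus the multinomial coefficient [2! / (i! j! k!)]. *)
Definition coef3 (e : exp3) : 'F_3 :=
  let k := (e.1.1 + e.1.2 + e.2)%N in
  if k == 0%N then 1 else if k == 2%N then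
    - ((2 %/ (e.1.1`! * e.1.2`! * e.2`!))%N)%:R else 0.

Lemma coef3_expand (a b c : 'F_3) :
  1 - (a + b + c) ^+ 2 =
  \sum_(e : exp3) coef3 e * (a ^+ e.1.1 * b ^+ e.1.2 * c ^+ e.2).
Proof.
rewrite -(pair_bigA _ (fun (p : 'I_3 * 'I_3) (k : 'I_3) =>
   coef3 (p, k) * (a ^+ p.1 * b ^+ p.2 * c ^+ k))) /=.
rewrite -(pair_bigA _ (fun (i j : 'I_3) => \sum_(k < 3)
   coef3 (i, j, k) * (a ^+ i * b ^+ j * c ^+ k))) /=.
rewrite !big_ord_recl !big_ord0 /coef3 /=.
rewrite /bump /= !factS !fact0.
rewrite !(muln1, mul1n, addn0, divn1) (_ : (2 %/ 2)%N = 1%N) //.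
ring.
Qed.

Lemma zero_test3 (a : 'F_3) : 1 - a ^+ 2 = (a == 0)%:R.
Proof. by case: a => [[|[|[|//]]] ?]; apply/val_inj. Qed.

Lemma zero_test3_row (m : nat) (x : 'rV['F_3]_m) :
  \prod_i (1 - x 0 i ^+ 2) = (x == 0)%:R.
Proof.
have [->|/eqP xN0] := eqVneq x 0.
  by rewrite big1 // => i _; rewrite mxE expr0n subr0.
have [i xi] : exists i, x 0 i != 0.
  apply/existsP; apply: contra_notT xN0 => /existsPn h.
  by apply/rowP => i; rewrite mxE; apply/eqP; have := h i; rewrite negbK.
by rewrite (bigD1 i) //= zero_test3 (negbTE xi) mul0r.
Qed.

Lemma char3_row (m : nat) (x : 'rV['F_3]_m) : x + x + x = 0.
Proof. by apply/rowP => i; rewrite !mxE; case: (x 0 i) => [[|[|[|//]]] ?]; apply/val_inj. Qed.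

Lemma zero_sum_expand (m : nat) (x y z : 'rV['F_3]_m) :
  (x + y + z == 0)%:R =
  \sum_(f : {ffun 'I_m -> exp3}) (\prod_i coef3 (f i)) *
    (monomial x [ffun i => (f i).1.1] * monomial y [ffun i => (f i).1.2]
     * monomial z [ffun i => (f i).2]).
Proof.
rewrite -zero_test3_row.
under eq_bigr => i _ do rewrite !mxE coef3_expand.
rewrite bigA_distr_bigA /=; apply: eq_bigr => f _.
rewrite !big_split /= /monomial; congr (_ * (_ * _ * _));
  by apply: eq_bigr => i _; rewrite ffunE.
Qed.

(** A nonzero coefficient forces degree at most 2 in every coordinate. The three exponents thus have
    total degree at most [2m], and the smallest has at most a third of that. *)
Lemma coef3_low (m : nat) (f : {ffun 'I_m -> exp3}) :
  \prod_i coef3 (f i) != 0 ->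
  [|| [ffun i => (f i).1.1] \in low_exponents m,
      [ffun i => (f i).1.2] \in low_exponents m |
      [ffun i => (f i).2] \in low_exponents m].
Proof.
move=> /prodf_neq0 cf.
have : (\sum_i ((f i).1.1 + (f i).1.2 + (f i).2) <= \sum_(i < m) 2)%N.
  apply: leq_sum => i _; have := cf i isT; rewrite /coef3.
  by do 2 case: ifP => [/eqP -> //|_]; rewrite eqxx.
rewrite sum_nat_const card_ord !big_split /= !inE => h.
have E (g : exp3 -> 'I_3) :
    (\sum_i ([ffun i => g (f i)] : {ffun 'I_m -> 'I_3}) i = \sum_i g (f i))%N.
  by apply: eq_bigr => i _; rewrite ffunE.
rewrite (E (fun e => e.1.1)) (E (fun e => e.1.2)) (E (fun e => e.2)).
move: h => /=; move: (\sum_i (f i).1.1)%N (\sum_i (f i).1.2)%N (\sum_i (f i).2)%N => a b c; lia.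
Qed.

(** Grouping the terms by the label [l f] factors the matrix through dimension [#|D|]. *)
Lemma sum_low_rank (R : fieldType) (I : finType) (L : finType) (D : {set L}) (r : nat)
    (P : pred I) (l : I -> L) (X : 'I_r -> L -> R) (Y : I -> 'I_r -> R) :
  (forall f, P f -> l f \in D) ->
  (\rank (\matrix_(i < r, j < r) \sum_(f | P f) X i (l f) * Y f j)%R <= #|D|)%N.
Proof.
move=> PD.
suff -> : \matrix_(i < r, j < r) (\sum_(f | P f) X i (l f) * Y f j)
  = (\matrix_(i < r, k < #|D|) X i (enum_val k)) *m
    (\matrix_(k < #|D|, j < r) \sum_(f | P f && (l f == enum_val k)) Y f j).
  by rewrite (leq_trans (mxrankM_maxl _ _)) // rank_leq_col.
apply/matrixP => i j; rewrite !mxE.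
rewrite (partition_big l (mem D)) //= big_enum_val /=.
apply: eq_bigr => k _; rewrite !mxE mulr_sumr.
by apply: eq_bigr => f /andP[_ /eqP ->].
Qed.

(* Summing the indicator of [x + y + z = 0] against a function [phi] on [A]
   orthogonal to the low-degree monomials leaves a diagonal matrix of rank at
   most [2 * #|low_exponents m|], since in every monomial of the indicator one
   of the three factors has degree at most [2m/3]; [phi] can be chosen equal to
   [1] at [#|A| - #|low_exponents m|] points. *)
Lemma cap_bound (m : nat) (A : {set 'rV['F_3]_m}) :
  (forall x y z, x \in A -> y \in A -> z \in A -> x + y + z = 0 -> x = y) ->
  (#|A| <= 3 * #|low_exponents m|)%N.
Proof.
move=> capA; set L := low_exponents m.
pose Z := \matrix_(i < #|A|, j < #|L|) monomial (enum_val i) (enum_val j).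
have [f [phi [f_inj phiK phi1]]] := row_base_unit_coords (kermx Z).
have rK : (#|A| <= \rank (kermx Z) + #|L|)%N.
  by rewrite mxrank_ker; have := rank_leq_col Z; lia.
move: f phi f_inj phiK phi1 rK; move: (\rank (kermx Z)) => r f phi f_inj phiK phi1 rK.
have phiZ e : e \in L -> \sum_k phi 0 k * monomial (enum_val k) e = 0.
  move=> eL; have /sub_kermxP/matrixP/(_ 0 (enum_rank_in eL e)) := phiK.
  rewrite !mxE => h; rewrite -[RHS]h; apply: eq_bigr => k _.
  by rewrite mxE enum_rankK_in.
pose x i := enum_val (f i).
pose c (h : {ffun 'I_m -> exp3}) := \prod_i coef3 (h i).
pose e1 (h : {ffun 'I_m -> exp3}) := [ffun i => (h i).1.1].
pose e2 (h : {ffun 'I_m -> exp3}) := [ffun i => (h i).1.2].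
pose e3 (h : {ffun 'I_m -> exp3}) := [ffun i => (h i).2].
pose s h := \sum_k phi 0 k * monomial (enum_val k) (e3 h).
pose P1 h := e1 h \in L.
pose P2 h := (e1 h \notin L) && (e2 h \in L).
pose M1 := \matrix_(i < r, j < r)
  \sum_(h | P1 h) monomial (x i) (e1 h) * (c h * s h * monomial (x j) (e2 h)).
(* The second group is written transposed, so that its low factor [e2 h] carries the row index, as
   [sum_low_rank] needs. *)
pose M2 := \matrix_(i < r, j < r)
  \sum_(h | P2 h) monomial (x i) (e2 h) * (c h * s h * monomial (x j) (e1 h)).
have E : 1%:M = M1 + M2^T.
  apply/matrixP => i j; rewrite !mxE.
  transitivity (\sum_k phi 0 k * (x i + x j + enum_val k == 0)%:R).
    have [<-|ij] := eqVneq i j.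
      rewrite (bigD1 (f i)) //= phi1 mul1r big1 => [|k kfi].
        by rewrite char3_row eqxx addr0.
      case: eqP; rewrite ?mulr0 // => h.
      have := capA _ _ _ (enum_valP (f i)) (enum_valP k) (enum_valP (f i)).
      rewrite -addrA (addrC (enum_val k)) addrA => /(_ h) /enum_val_inj hk.
      by rewrite hk eqxx in kfi.
    rewrite big1 // => k _; case: eqP; rewrite ?mulr0 // => h.
    have := capA _ _ _ (enum_valP (f i)) (enum_valP (f j)) (enum_valP k) h.
    by move=> /enum_val_inj /f_inj hij; rewrite hij eqxx in ij.
  under eq_bigr => k _ do rewrite zero_sum_expand mulr_sumr.
  rewrite exchange_big /=.
  transitivity (\sum_h c h * s h * (monomial (x i) (e1 h) * monomial (x j) (e2 h))).
    apply: eq_bigr => h _; rewrite /s mulr_sumr mulr_suml.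
    by apply: eq_bigr => k _; rewrite /c /e1 /e2 /e3; ring.
  rewrite (bigID P1) /=; congr (_ + _); first by apply: eq_bigr => h _; ring.
  rewrite (bigID (fun h => e2 h \in L)) /= [X in _ + X]big1 ?addr0.
    by apply: eq_bigr => h _; ring.
  move=> h /andP[h1 h2]; have [->|c0] := eqVneq (c h) 0; first by rewrite !mul0r.
  have := coef3_low c0; rewrite -/L -/(e1 h) -/(e2 h) -/(e3 h).
  rewrite (negbTE h2); rewrite /P1 in h1; rewrite (negbTE h1) /= => h3.
  by rewrite /s phiZ // mulr0 mul0r.
have r1 : (\rank M1 <= #|L|)%N.
  exact: (sum_low_rank (P := P1) (l := e1) (fun i => monomial (x i))
    (fun h j => c h * s h * monomial (x j) (e2 h))).
have r2 : (\rank M2 <= #|L|)%N.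
  apply: (sum_low_rank (P := P2) (l := e2) (fun i => monomial (x i))
    (fun h j => c h * s h * monomial (x j) (e1 h))).
  by move=> h /andP[].
have := mxrank_add M1 M2^T; rewrite -E mxrank1 mxrank_tr; lia.
Qed.

(** * Counting lines in dense sets *)

Definition line_starts (F : finFieldType) (n : nat) (A : {set 'rV[F]_n}) (d : 'rV[F]_n)
  : {set 'rV[F]_n} := finset (fun x => [forall a : F, x + a *: d \in A]).

Definition line_count (F : finFieldType) (n : nat) (A : {set 'rV[F]_n}) : nat :=
  (\sum_d #|line_starts A d|)%N.

Lemma card_sum_shift (T : finZmodType) (A : {set T}) (c : T) :
  (\sum_x (x + c \in A)%R = #|A|)%N.
Proof.
rewrite -sum1_card [RHS]big_mkcond /= (reindex_inj (addIr (- c))) /=.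
by apply: eq_bigr => x _; rewrite addrNK; case: (x \in A).
Qed.

Lemma card_sum_mem (T : finType) (A : {set T}) : (\sum_x (x \in A) = #|A|)%N.
Proof. by rewrite -sum1_card [RHS]big_mkcond. Qed.

(** [p *m M] is uniform for uniform [M]: if [p *m c = 1], shifting [M] by [c *m w] moves [p *m M] by
    [w]. *)
Lemma sum_mulmx (F : finFieldType) (m n : nat) (p : 'rV[F]_m) (g : 'rV[F]_n -> nat) :
  p != 0 ->
  ((\sum_(M : 'M[F]_(m, n)) g (p *m M)%R) * #|{: 'rV[F]_n}| =
   #|{: 'M[F]_(m, n)}| * \sum_w g w)%N.
Proof.
move=> p0; have [c pc] : exists c : 'cV_m, p *m c = 1%:M.
  have [i pi] : exists i, p 0 i != 0.
    apply/existsP; apply: contraNT p0 => /existsPn h.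
    by apply/eqP/rowP => i; rewrite mxE; apply/eqP; have := h i; rewrite negbK.
  exists ((p 0 i)^-1 *: delta_mx i 0); rewrite -scalemxAr -colE.
  by apply/matrixP => j k; rewrite !ord1 !mxE eqxx mulVf.
rewrite mulnC -sum_nat_const.
rewrite (eq_bigr (fun w => \sum_(M : 'M[F]_(m, n)) g (p *m M + w)%R)%N).
  rewrite exchange_big /= -sum_nat_const; apply: eq_bigr => M _.
  by rewrite [RHS](reindex_inj (addrI (p *m M))).
move=> w _; rewrite (reindex_inj (addIr (c *m w))) /=; apply: eq_bigr => M _.
by rewrite mulmxDr mulmxA pc mul1mx.
Qed.

(** In characteristic 3, distinct [x], [y] with [x + y + z = 0] give the line [x, y, z] of direction
    [y - x]. Deleting the starts of all nonconstant lines therefore leaves a cap. *)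
Lemma cap_deletion (m : nat) (A : {set 'rV['F_3]_m}) :
  (#|A| <= 3 * #|low_exponents m| + \sum_(d | d != 0%R) #|line_starts A d|)%N.
Proof.
pose B := \bigcup_(d | d != 0) line_starts A d.
have cB : (#|B| <= \sum_(d | d != 0%R) #|line_starts A d|)%N.
  rewrite /B; elim/big_ind2: _ => [|X a Y b ha hb|//]; first by rewrite cards0.
  by rewrite (leq_trans (leq_card_setU _ _)) // leq_add.
suff : (#|A :\: B| <= 3 * #|low_exponents m|)%N.
  rewrite -(cardsID B A) addnC => h; apply: leq_add => //.
  exact: leq_trans (subset_leq_card (subsetIr A B)) cB.
apply: cap_bound => x y z; rewrite !inE => /andP[xB xA] /andP[_ yA] /andP[_ zA] s0.
apply/eqP; rewrite eq_sym -subr_eq0; apply: contraNT xB => d0.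
apply/bigcupP; exists (y - x) => //; rewrite inE; apply/forallP => a.
have : [|| a == 0, a == 1 | a == 2%:R].
  by case: a => [[|[|[|//]]] ?].
case/or3P => /eqP ->; rewrite ?scale0r ?addr0 ?scale1r ?subrKC //.
suff -> : x + 2%:R *: (y - x) = z by [].
apply/eqP; rewrite -subr_eq0 scaler_nat mulr2n.
have <- : (y + y + y) - (x + y + z) = x + (y - x + (y - x)) - z.
  by apply/rowP => i; rewrite !mxE; ring.
by rewrite char3_row s0 subr0.
Qed.

(* Average [cap_deletion] over the pullbacks of [A] along all affine maps
   [u |-> x + u *m M]: for [d != 0] the pair [(x + u *m M, d *m M)] is uniform. *)
Lemma cap_supersaturation (m n : nat) (A : {set 'rV['F_3]_n}) :
  (3 ^ m * #|A| * 3 ^ n <=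
     3 * #|low_exponents m| * (3 ^ n * 3 ^ n) + 3 ^ m * 3 ^ m * line_count A)%N.
Proof.
have cr k : #|{: 'rV['F_3]_k}| = (3 ^ k)%N by rewrite card_mx card_Fp // mul1n.
pose L := (3 * #|low_exponents m|)%N.
pose A' (x : 'rV['F_3]_n) (M : 'M['F_3]_(m, n)) : {set 'rV['F_3]_m} :=
  finset (fun u => x + u *m M \in A).
pose W := #|{: 'M['F_3]_(m, n)}|.
have W0 : (0 < W)%N by rewrite /W; apply/card_gt0P; exists 0.
have E1 : (\sum_M \sum_x #|A' x M| = W * (3 ^ m * #|A|))%N.
  rewrite -sum_nat_const; apply: eq_bigr => M _.
  under eq_bigr => x _ do rewrite -card_sum_mem.
  rewrite exchange_big /= -cr -sum_nat_const; apply: eq_bigr => u _.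
  by rewrite -(card_sum_shift A (u *m M)); apply: eq_bigr => x _; rewrite inE.
have E2 : ((\sum_(M : 'M['F_3]_(m, n)) \sum_x \sum_(d | d != 0%R) #|line_starts (A' x M) d|) * 3 ^ n
    <= 3 ^ m * 3 ^ m * W * line_count A)%N.
  have E M x d : #|line_starts (A' x M) d| =
      (\sum_u (x + u *m M \in line_starts A (d *m M))%R)%N.
    rewrite -card_sum_mem; apply: eq_bigr => u _; congr (nat_of_bool _).
    rewrite !inE; apply: eq_forallb => a.
    by rewrite inE mulmxDl -scalemxAl addrA.
  under eq_bigr => M _ do (under eq_bigr => x _ do (under eq_bigr => d _ do rewrite E);
    rewrite exchange_big /=).
  rewrite exchange_big /= big_distrl /=.
  rewrite -!mulnA -[X in (_ <= X * _)%N](cr m) -sum_nat_const [X in (X <= _)%N]big_mkcond.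
  apply: leq_sum => d _ /=.
  case: ifP => // d0.
  have -> : (\sum_M \sum_x \sum_u (x + u *m M \in line_starts A (d *m M))%R =
      3 ^ m * \sum_(M : 'M['F_3]_(m, n)) #|line_starts A (d *m M)%R|)%N.
    rewrite big_distrr; apply: eq_bigr => M _; rewrite exchange_big /= -cr -sum_nat_const.
    by apply: eq_bigr => u _; rewrite card_sum_shift.
  by rewrite -(cr n) -mulnA (sum_mulmx (fun w => #|line_starts A w|)) // mulnA.
have E3 : (\sum_M \sum_x #|A' x M| <= W * 3 ^ n * L +
    \sum_(M : 'M['F_3]_(m, n)) \sum_x \sum_(d | d != 0%R) #|line_starts (A' x M) d|)%N.
  rewrite -mulnA -sum_nat_const -big_split /=; apply: leq_sum => M _.
  rewrite -(cr n) -sum_nat_const -big_split /=; apply: leq_sum => x _.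
  exact: cap_deletion.
rewrite -(leq_pmul2l W0); move: E1 E2 E3; rewrite -/L => -> E2 E3.
have := leq_mul E3 (leqnn (3 ^ n)); rewrite mulnDl; move: E2.
move: (\sum_M _)%N (3 ^ m)%N (3 ^ n)%N (line_count A) #|A| L W {E3 W0} => S a b T c l w.
nia.
Qed.

Lemma line_count_F2 (n : nat) (A : {set 'rV['F_2]_n}) : line_count A = (#|A| * #|A|)%N.
Proof.
rewrite -[X in (X * _)%N]card_sum_mem big_distrl /=.
transitivity (\sum_d \sum_x (x \in A) * (x + d \in A)%R)%N.
  apply: eq_bigr => d _; rewrite -card_sum_mem; apply: eq_bigr => x _.
  rewrite inE mulnb; congr (nat_of_bool _); apply/forallP/andP => [h|[x0 x1] a].
    by have := h 0; have := h 1; rewrite scale0r scale1r addr0.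
  have : (a == 0) || (a == 1) by case: a => [[|[|//]] ?].
  by case/orP => /eqP ->; rewrite ?scale0r ?addr0 ?scale1r.
rewrite exchange_big /=; apply: eq_bigr => x _; rewrite -big_distrr /=.
by congr (_ * _)%N; rewrite -(card_sum_shift A x); apply: eq_bigr => d _; rewrite addrC.
Qed.

(** * Extending monochromatic subspaces *)

Lemma sub_addsmx_row (F : fieldType) (m n : nat) (U : 'M[F]_(m, n)) (v w : 'rV[F]_n) :
  (w <= U + v)%MS -> exists a, exists2 u : 'rV_n, (u <= U)%MS & w = u + a *: v.
Proof.
case/sub_addsmxP => -[u1 u2] /= ->; exists (u2 0 0), (u1 *m U); first exact: submxMl.
by rewrite [u2 in LHS]mx11_scalar mul_scalar_mx.
Qed.

Lemma rank_adds_row (F : fieldType) (m n : nat) (U : 'M[F]_(m, n)) (v : 'rV[F]_n) :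
  ~~ (v <= U)%MS -> \rank (U + v)%MS = (\rank U).+1.
Proof.
move=> vU; apply/eqP; rewrite eqn_leq; apply/andP; split.
  by apply: leq_trans (mxrank_adds_leqif U v).1 _; have := rank_leq_row v; lia.
by apply: rank_ltmx; rewrite ltmxE addsmxSl addsmx_sub submx_refl.
Qed.

Lemma card_rowspace (F : finFieldType) (m n : nat) (U : 'M[F]_(m, n)) :
  #|finset (fun v : 'rV[F]_n => (v <= U)%MS)| = (#|F| ^ \rank U)%N.
Proof. exact: card_rowg. Qed.

(** A vector of [U + v] outside [U] is a multiple of some [u + v], so only these lines are new. *)
Lemma mono_adds_row (F : fieldType) (n : nat) (col : 'M[F]_n -> bool) (b : bool)
    (U : 'M[F]_n) (v : 'rV[F]_n) :
  mono_subspace col b U ->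
  (forall u : 'rV_n, (u <= U)%MS -> col <<u + v>>%MS = b) ->
  mono_subspace col b (U + v)%MS.
Proof.
move=> hU hv w w0 /sub_addsmx_row [a [u uU wE]].
have [a0|a0] := eqVneq a 0.
  by move: w0; rewrite wE a0 scale0r addr0 => w0; apply: hU.
have <- : (<<a^-1 *: w>> = <<w>>)%MS by apply/eq_genmx/eqmx_scale; rewrite invr_eq0.
rewrite wE scalerDr scalerA mulVf // scale1r; apply: hv.
by rewrite scalemx_sub.
Qed.

Definition red_vectors (F : finFieldType) (n : nat) (col : 'M[F]_n -> bool) : {set 'rV[F]_n} :=
  finset (fun v => (v != 0) && col <<v>>%MS).

(** A blue [U] of dimension [k < t] fails to extend by [v] only if [v] lies in [U] or in [r - U] for
    some red [r]. If there are fewer than [q^(n - t)] red vectors, this excludes at most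
    [q^(n - t + k) < q^n] vectors. *)
Lemma blue_subspace_or_dense_red (F : finFieldType) (n t : nat) (col : 'M[F]_n -> bool) :
  (t <= n)%N ->
  (exists U : 'M[F]_n, \rank U = t /\ mono_subspace col false U) \/
  (#|F| ^ (n - t) <= #|red_vectors col|)%N.
Proof.
move=> tn; have [|few] := leqP (#|F| ^ (n - t)) #|red_vectors col|; [by right | left].
suff H k : (k <= t)%N ->
  exists U : 'M[F]_n, \rank U = k /\ mono_subspace col false U by exact: H.
elim: k => [_|k IH kt].
  exists 0; split; first exact: mxrank0.
  by move=> v v0; rewrite submx0 (negbTE v0).
have [U [rU hU]] := IH (ltnW kt).
pose sp := finset (fun v : 'rV[F]_n => (v <= U)%MS).
pose bad := sp :|: [set (r - u)%R | r in red_vectors col, u in sp].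
have csp : #|sp| = (#|F| ^ k)%N by rewrite card_rowspace rU.
have F1 : (1 < #|F|)%N := card_finNzRing_gt1 F.
have cbad : (#|bad| < #|[set: 'rV[F]_n]|)%N.
  rewrite cardsT card_mx mul1n.
  apply: leq_ltn_trans (leq_card_setU _ _) _.
  have h : (#|[set (r - u)%R | r in red_vectors col, u in sp]| <= #|red_vectors col| * #|sp|)%N.
    by rewrite curry_imset2X (leq_trans (leq_imset_card _ _)) // cardsX.
  apply: leq_ltn_trans (leq_add (leqnn _) h) _; rewrite -mulSn csp.
  apply: leq_ltn_trans (leq_mul few (leqnn _)) _.
  by rewrite -expnD ltn_exp2l //; lia.
have [v _ vbad] : exists2 v, v \in [set: 'rV[F]_n] & v \notin bad.
  by apply/subsetPn; apply: contraL cbad => /subset_leq_card; rewrite -leqNgt.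
move: vbad; rewrite !inE negb_or => /andP[vU vR].
exists (U + v)%MS; split; first by rewrite rank_adds_row // rU.
apply: mono_adds_row => // u uU; apply/negbTE; apply: contra vR => cuv.
apply/imset2P; exists (u + v) u; rewrite ?inE //; last by rewrite addrC addKr.
rewrite cuv andbT; apply: contra vU; rewrite addrC addr_eq0 => /eqP ->.
by rewrite eqmx_opp.
Qed.

Lemma line_starts_sub (F : finFieldType) (n : nat) (A : {set 'rV[F]_n}) d :
  line_starts A d \subset A.
Proof.
by apply/fintype.subsetP => x; rewrite inE => /forallP /(_ 0); rewrite scale0r addr0.
Qed.

(** * Affine subspaces of dense sets *)

(** Densities are recorded by their exponents in base [q], so that passing to line starts becomes
    the affine recursion [b -> C b + K + 1]. *)
Definition supersaturated (R : realType) (F : finFieldType) (C K : R) : Prop :=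
  forall (n : nat) (A : {set 'rV[F]_n}) (b : R), 0 <= b ->
    #|F|%:R `^ (n%:R - b) <= #|A|%:R ->
    #|F|%:R `^ (2 * n%:R - C * b - K) <= (line_count A)%:R.

Section Affine.
Variables (R : realType) (F : finFieldType) (C K : R).
Hypotheses (C1 : 1 <= C) (K0 : 0 <= K) (SS : supersaturated F C K).
Let q : R := #|F|%:R.

Let q2 : 2 <= q. Proof. by rewrite ler_nat; exact: card_finNzRing_gt1. Qed.
Let q1 : 1 <= q. Proof. by apply: le_trans q2; lra. Qed.
Let q0 : 0 < q. Proof. by apply: lt_le_trans q1. Qed.
Let powD x y : q `^ (x + y) = q `^ x * q `^ y.
Proof. by rewrite powRD // (gt_eqF q0) implybT. Qed.

Lemma affine_subspace_in_dense (b : nat -> R) (n D : nat) (A : {set 'rV[F]_n}) :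
  0 <= b 0%N -> (forall k, b k.+1 = C * b k + K + 1) ->
  q `^ (n%:R - b 0%N) <= #|A|%:R -> D%:R + b D <= n%:R ->
  exists (V : 'M[F]_n) (S : {set 'rV[F]_n}),
   [/\ \rank V = D, S \subset A,
    forall x v : 'rV_n, x \in S -> (v <= V)%MS -> x + v \in S &
    q `^ (n%:R - b D) <= #|S|%:R].
Proof.
move=> b0 bS hA.
have bge k : 0 <= b k 
  by elim: k => // k IH; rewrite bS; have := mulr_ge0 (le_trans ler01 C1) IH; move: K0; lra.
elim: D => [_|D IH hD].
  exists 0, A; split; rewrite ?mxrank0 //.
  by move=> x v xA; rewrite submx0 => /eqP ->; rewrite addr0.
have bD := bge D; have bDS := bS D.
have [|V [S [rV SA SV cS]]] := IH.
  by move: hD; rewrite -natr1 bDS; have := ler_peMl bD C1; move: K0; lra.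
have hT := SS bD cS.
(* Otherwise directions inside [V] contribute at most [X] and the others at most [X * q], with
   [X = q^(2n - b (D+1) - 1)]; but the [+ 1] in the recursion makes the count at least [X * q * q],
   which is larger as [q >= 2]. *)
have [d dV cd] : exists2 d : 'rV[F]_n, ~~ (d <= V)%MS &
    q `^ (n%:R - b D.+1) <= #|line_starts S d|%:R.
  apply: contrapT => /forall2NP nex; move: hT; apply/negP; rewrite -ltNge.
  rewrite /line_count (bigID (fun d => (d <= V)%MS)) /= natrD.
  have h1 : (\sum_(d : 'rV[F]_n | (d <= V)%MS) #|line_starts S d|)%:R <= q `^ (D%:R + n%:R).
    rewrite powD !powR_mulrn ?(ltW q0) // -!natrX -natrM ler_nat -rV -card_rowspace.
    rewrite -sum1_card big_distrl /= [X in (_ <= X)%N](eq_bigl (fun d => (d <= V)%MS)); last first.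
      by move=> d; rewrite inE.
    by apply: leq_sum => d _; rewrite mul1n (leq_trans (max_card _)) // card_mx mul1n.
  have h2 : (\sum_(d : 'rV[F]_n | ~~ (d <= V)%MS) #|line_starts S d|)%:R
       <= q `^ (n%:R + (n%:R - b D.+1)).
    rewrite powD powR_mulrn ?(ltW q0) // -natrX.
    have <- : #|{: 'rV[F]_n}| = (#|F| ^ n)%N by rewrite card_mx mul1n.
    rewrite natr_sum mulr_natl -sumr_const [leLHS]big_mkcond /=; apply: ler_sum => d _.
    case: ifP => dV; last exact: powR_ge0.
    have [/negP|/negP] := nex d; first by rewrite dV.
    by rewrite -ltNge => /ltW.
  apply: le_lt_trans (lerD h1 h2) _.
  have -> : 2 * n%:R - C * b D - K = n%:R + (n%:R - b D.+1) + 1 by rewrite bDS; ring.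
  rewrite [ltRHS]powD powRr1 ?(ltW q0) //.
  have : q `^ (D%:R + n%:R) <= q `^ (n%:R + (n%:R - b D.+1) - 1).
    by apply: ler_powR => //; move: hD; rewrite -natr1; lra.
  set X := q `^ (n%:R + (n%:R - b D.+1) - 1).
  have -> : q `^ (n%:R + (n%:R - b D.+1)) = X * q.
    by rewrite -[in LHS](subrK 1 (n%:R + _)) powD powRr1 // ltW.
  have X0 : 0 < X by apply: powR_gt0.
  have : X * 2 <= X * q by rewrite ler_pM2l.
  have : X * q * 2 <= X * q * q by rewrite ler_pM2l // mulr_gt0.
  by lra.
exists (V + d)%MS, (line_starts S d); split => //.
- by rewrite rank_adds_row // rV.
- exact: fintype.subset_trans (line_starts_sub _ _) SA.
- move=> x w xS /sub_addsmx_row [a [u uV ->]].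
  rewrite inE; apply/forallP => c.
  (* The [d]-component moves along the line; the [V]-component is absorbed by the invariance of
     [S]. *)
  have -> : x + (u + a *: d) + c *: d = x + (a + c) *: d + u.
    by apply/rowP => i; rewrite !mxE; ring.
  by apply: SV => //; move: xS; rewrite inE => /forallP.
Qed.

End Affine.

(** * The Ramsey recursion and the tower *)

Lemma mono_mulmx (F : fieldType) (m n p : nat) (col : 'M[F]_n -> bool) (b : bool)
    (V : 'M[F]_(m, n)) (U : 'M[F]_(p, m)) :
  row_free V -> mono_subspace (fun B : 'M[F]_m => col <<B *m V>>%MS) b U ->
  mono_subspace col b (U *m V).
Proof.
move=> fV hU v v0 /submxP [y vE].
have yU0 : y *m U != 0.
  by apply: contraNneq v0 => h; rewrite vE mulmxA h mul0mx.
have := hU _ yU0 (submxMl _ _); rewrite vE mulmxA => <-; congr col.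
by apply/eq_genmx/eqmx_sym/eqmxMr/genmxE.
Qed.

Lemma mono_genmx (F : fieldType) (m n : nat) (col : 'M[F]_n -> bool) (b : bool)
    (U : 'M[F]_(m, n)) : mono_subspace col b U -> mono_subspace col b <<U>>%MS.
Proof. by move=> hU v v0; rewrite genmxE; apply: hU. Qed.

Lemma vramsey_step (R : realType) (F : finFieldType) (C K : R) (b : nat -> R)
    (s t d n : nat) :
  1 <= C -> 0 <= K -> supersaturated F C K ->
  b 0%N = t%:R -> (forall k, b k.+1 = C * b k + K + 1) ->
  vramsey_prop F s t d -> (t <= n)%N -> d%:R + b d <= n%:R ->
  vramsey_prop F s.+1 t n.
Proof.
move=> C1 K0 SS b0 bS hd tn hn col.
have [|dense] := blue_subspace_or_dense_red col tn; first by right.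
have [||V [S [rV SA SV cS]]] :=
    @affine_subspace_in_dense R F C K C1 K0 SS b n d (red_vectors col) _ bS _ hn.
- by rewrite b0 ler0n.
- by rewrite b0 -natrB // powR_mulrn ?ler0n // -natrX ler_nat.
have [x xS] : exists x, x \in S.
  apply/card_gt0P; rewrite -(ltr_nat R); apply: lt_le_trans cS.
  by rewrite powR_gt0 // ltr0n (ltn_trans _ (card_finNzRing_gt1 F)).
have xV v : (v <= V)%MS -> (v + x != 0) && col <<v + x>>%MS.
  by move=> vV; have := fintype.subsetP SA _ (SV x v xS vV); rewrite addrC inE.
clear SA SV cS xS; case: d / rV hd hn => hd hn.
have fV : row_free (row_base V) := row_base_free V.
have [[U [rU hU]]|[U [rU hU]]] := hd (fun B => col <<B *m row_base V>>%MS); last first.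
  right; exists <<U *m row_base V>>%MS; split.
    by rewrite mxrank_gen mxrankMfree.
  exact/mono_genmx/mono_mulmx.
left; pose W := <<U *m row_base V>>%MS.
have WV : (W <= V)%MS by rewrite genmxE (submx_trans (submxMl _ _)) // eq_row_base.
exists (W + x)%MS; split.
  rewrite rank_adds_row ?mxrank_gen ?mxrankMfree ?rU //.
  (* If [x] were in [V], then [x + V] would contain [0], which is not a red vector. *)
  apply/negP => xW; have := xV (- x); rewrite addNr eqxx eqmx_opp /=.
  by move=> /(_ (submx_trans xW WV)).
apply: mono_adds_row; first exact/mono_genmx/mono_mulmx.
by move=> u uW; have /andP[] := xV u (submx_trans uW WV).
Qed.

Lemma vramsey_red_line (F : fieldType) (t : nat) : vramsey_prop F 1 t t.
Proof.
move=> col.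
have [[v [v0 cv]]|none] := pselect (exists v : 'rV[F]_t, v != 0 /\ col <<v>>%MS).
  left; exists <<v>>%MS; split; first by rewrite mxrank_gen rank_rV v0.
  apply: mono_genmx => w w0 /sub_rVP [a wE]; rewrite -[RHS]cv; congr col.
  rewrite wE; apply/eq_genmx/eqmx_scale.
  by apply: contraNneq w0 => a0; rewrite wE a0 scale0r.
right; exists 1%:M; split; first exact: mxrank1.
by move=> v v0 _; apply/negbTE/negP => cv; apply: none; exists v.
Qed.

(** The slack [t] is carried along the induction: it raises the next exponent from [d] to [d + t],
    and the extra [C^t] pays for the factor [t + k + 1]. *)
Lemma vramsey_tower (R : realType) (F : finFieldType) (C K k : R) (t : nat) :
  2 <= C -> 0 <= K -> 1 <= k -> C * k = K + 1 + k -> t%:R + k + 1 <= C ^+ t ->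
  supersaturated F C K -> (1 < t)%N ->
  forall s, exists n,
    [/\ (t <= n)%N, n%:R + t%:R <= tower s C (2 * t)%:R & vramsey_prop F s.+1 t n].
Proof.
move=> C2 K0 k1 Ck Ct SS t2.
have C1 : 1 <= C by lra.
elim=> [|s [d [td dtow hd]]].
  exists t; split => //; last exact: vramsey_red_line.
  by rewrite /= -natrD mul2n addnn.
(* By the choice of [k], [b i + k] is geometric of ratio [C], which solves the recursion. *)
pose b i := C ^+ i * (t%:R + k) - k.
have room : d%:R + t%:R + C ^+ d * (t%:R + k) <= C ^+ (d + t).
  have h1 : d%:R + t%:R <= C ^+ d.
    have h : (d + t <= 2 ^ d)%N.
      apply: (@leq_trans (2 * d)); first by lia.
      by elim: d {dtow hd td} => // [[|d]] // IH; rewrite expnS; lia.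
    rewrite -natrD; apply: (@le_trans _ _ (2 ^ d)%:R); first by rewrite ler_nat.
    by rewrite natrX lerXn2r // nnegrE; lra.
  have h2 : C ^+ d * (t%:R + k + 1) <= C ^+ d * C ^+ t.
    by rewrite ler_wpM2l // exprn_ge0 //; lra.
  by rewrite exprD; move: h1 h2; rewrite !mulrDr mulr1; lra.
have dC : 1 <= C ^+ d by rewrite exprn_ege1.
have P0 : 0 <= C ^+ (d + t) by rewrite exprn_ge0 //; lra.
have /andP[Nle Nlt] := truncn_itv P0.
have tR : 2 <= t%:R :> R by rewrite ler_nat.
have h3 : t%:R + k <= C ^+ d * (t%:R + k) by rewrite ler_peMl //; lra.
have tN : (t + t <= Num.truncn (C ^+ (d + t)))%N.
  rewrite truncn_ge_nat // natrD; apply: le_trans room.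
  by have : t%:R <= d%:R :> R by [rewrite ler_nat]; lra.
move: (Num.truncn _) Nle Nlt tN => N Nle Nlt tN.
(* Removing [t] restores the slack. Rounding down loses less than 1, covered by the [- k] in [b d]
   since [k >= 1]. *)
exists (N - t)%N; split.
- by lia.
- rewrite -natrD subnK; last by lia.
  apply: le_trans Nle _ => /=; rewrite -powR_mulrn; last by lra.
  by apply: ler_powR; rewrite // natrD.
- apply: (vramsey_step (b := b)) C1 K0 SS _ _ hd _ _.
  + by rewrite /b expr0; ring.
  + by move=> i; rewrite /b exprS mulrBr -mulrA Ck; ring.
  + by lia.
  + rewrite natrB; last by lia.
    by move: Nlt; rewrite -natr1 /b; lra.
Qed.

(** * Supersaturation exponents for [q = 2] and [q = 3] *)

Lemma supersaturated_F2 (R : realType) : @supersaturated R 'F_2 2 0.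
Proof.
move=> n A b b0; rewrite card_Fp // line_count_F2 natrM => h.
apply: le_trans (ler_pM _ _ h h); rewrite ?powR_ge0 // -powRD.
  by apply: ler_powR; lra.
by rewrite pnatr_eq0 implybT.
Qed.

(* Rankin's trick: [1 <= x^(deg e - 2m/3)] for every low exponent [e]. *)
Lemma low_exponents_le (R : realType) (m : nat) (x : R) : 0 < x < 1 ->
  #|low_exponents m|%:R * (x `^ (2 / 3)) ^+ m <= (1 + x + x ^+ 2) ^+ m.
Proof.
move=> /andP[x0 x1].
have -> : (1 + x + x ^+ 2) ^+ m = \sum_(e : {ffun 'I_m -> 'I_3}) \prod_i x ^+ e i.
  have -> : 1 + x + x ^+ 2 = \sum_(j < 3) x ^+ j.
    by rewrite !big_ord_recl big_ord0 /= addr0 addrA.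
  rewrite -[m in LHS]card_ord -prodr_const.
  by rewrite (bigA_distr_bigA (fun (i : 'I_m) (j : 'I_3) => x ^+ j)).
rewrite mulr_natl -sumr_const [leLHS]big_mkcond /=; apply: ler_sum => e _.
case: ifP => [|_]; last by apply: prodr_ge0 => i _; apply/exprn_ge0/ltW.
rewrite inE prodrXr -!powR_mulrn ?powR_ge0 ?(ltW x0) // -powRrM => he.
apply: ger_powR; first by rewrite x0 ltW.
have : (3 * \sum_i e i)%:R <= (2 * m)%:R :> R by rewrite ler_nat.
by rewrite !natrM; lra.
Qed.

Section CapSetConstant.
Variable R : realType.

Let G : set R := [set (1 + x + x ^+ 2) / (x `^ (2 / 3)) | x in `]0, 1[%classic]%classic.

Let lb_gamma0 (y : R) :
  (forall x, 0 < x < 1 -> y <= (1 + x + x ^+ 2) / (x `^ (2 / 3))) -> y <= gamma0 R.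
Proof.
move=> h; apply: lb_le_inf.
  by exists ((1 + 2^-1 + 2^-1 ^+ 2) / (2^-1 `^ (2 / 3))), 2^-1 => //=; rewrite in_itv /=; lra.
by move=> _ [x hx <-]; apply: h; move: hx; rewrite /= in_itv.
Qed.

(** For [x < 1], [x^(2/3) <= sqrt x], while [1 + x >= 2 sqrt x]. This crude bound suffices for
    [C0 >= 3]. *)
Lemma gamma0_ge2 : 2 <= gamma0 R.
Proof.
apply: lb_gamma0 => x /andP[x0 x1].
rewrite ler_pdivlMr ?powR_gt0 //.
have h : x `^ (2 / 3) <= x `^ (2^-1) by apply: ger_powR; [rewrite x0 ltW | lra].
have : x `^ (2^-1) * x `^ (2^-1) = x.
  rewrite -powRD; last by rewrite gt_eqF ?implybT.
  by rewrite (_ : 2^-1 + 2^-1 = 1) ?powRr1 ?ltW //; lra.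
by move: (x `^ _) (x `^ _) h => u v h vv; nra.
Qed.

Lemma gamma0_lt3 : gamma0 R < 3.
Proof.
(* At [x = y^3] the power [x^(2/3) = y^2] is rational, and the value is about 2.77. *)
pose y : R := 4 / 5.
have y23 : (y ^+ 3) `^ (2 / 3) = y ^+ 2.
  rewrite -powR_mulrn; last by rewrite /y; lra.
  rewrite -powRrM -powR_mulrn; last by rewrite /y; lra.
  by congr (_ `^ _); lra.
apply: (@le_lt_trans _ _ ((1 + y ^+ 3 + y ^+ 3 ^+ 2) / ((y ^+ 3) `^ (2 / 3)))).
  apply: ge_inf.
    exists 0 => _ [x + <-]; rewrite /= in_itv /= => /andP[x0 x1].
    by rewrite divr_ge0 ?powR_ge0 //; nra.
  by exists (y ^+ 3) => //=; rewrite in_itv /= /y; lra.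
by rewrite y23 /y; lra.
Qed.

(** By [low_exponents_le], the [m]-th root of the count is a lower bound for the set whose infimum
    is [gamma0]; [m = 0] is treated apart, having no root. *)
Lemma low_exponents_le_gamma0 (m : nat) : #|low_exponents m|%:R <= gamma0 R ^+ m.
Proof.
case: m => [|m].
  by rewrite expr0 -[leRHS]/(1%:R) ler_nat (leq_trans (max_card _)) // card_ffun !card_ord.
set L := #|_|; have L0 : 0 <= L%:R :> R by rewrite ler0n.
have -> : L%:R = (L%:R `^ (m.+1%:R^-1)) ^+ m.+1 :> R.
  by rewrite -powR_mulrn ?powR_ge0 // -powRrM mulVf ?powRr1.
apply: lerXn2r; rewrite ?nnegrE ?powR_ge0 //; first by have := gamma0_ge2; lra.
apply: lb_gamma0 => x hx; have := low_exponents_le m.+1 hx; rewrite -/L => h.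
have /andP[x0 x1] := hx.
have g0 : 0 <= (1 + x + x ^+ 2) / x `^ (2 / 3) by rewrite divr_ge0 ?powR_ge0 //; nra.
rewrite -(@ler_pXn2r _ m.+1) ?nnegrE ?powR_ge0 //.
rewrite -powR_mulrn ?powR_ge0 // -powRrM mulVf ?powRr1 //.
by rewrite expr_div_n ler_pdivlMr // exprn_gt0 // powR_gt0.
Qed.

Let l := ln (gamma0 R) / ln 3.

Let ln3 : 0 < ln 3 :> R. Proof. by rewrite ln_gt0 //; lra. Qed.

Let gammaE : gamma0 R = 3 `^ l.
Proof.
rewrite /powR pnatr_eq0 /=.
by rewrite /l divfK ?gt_eqF // lnK // posrE; have := gamma0_ge2; lra.
Qed.

Let l_lt1 : l < 1.
Proof.
rewrite ltr_pdivrMr // mul1r ltr_ln ?posrE; have := gamma0_ge2; have := gamma0_lt3; lra.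
Qed.

Let l_ge : 2^-1 <= l.
Proof.
rewrite ler_pdivlMr // mulrC ler_pdivrMr // mulrC -[leRHS]/(2%:R * _) mulr_natl mulr2n.
have g2 := gamma0_ge2.
rewrite -lnM ?posrE; [|lra|lra].
by rewrite ler_ln ?posrE; nra.
Qed.

Lemma C0_ge3 : 3 <= C0 R.
Proof.
rewrite /C0 -/l mul1r; have := l_lt1; have := l_ge => h1 h2.
suff : 2 <= (1 - l)^-1 by lra.
by rewrite -[2]invrK lef_pV2 ?posrE; lra.
Qed.

Lemma supersaturated_F3 : @supersaturated R 'F_3 (C0 R) (2 * C0 R).
Proof.
move=> n A b b0; rewrite card_Fp // => hA.
pose c := 1 - l; have c0 : 0 < c by rewrite /c; have := l_lt1; lra.
(* An [m] just above [(b + 2) / c] makes the cap term at most a third of the main one. As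
   [m <= (b + 2) / c + 1], the line count keeps the exponent [2n - (1 + 1/c) (b + 2)], where
   [1 + 1/c = C0]. *)
pose m := (Num.truncn ((b + 2) / c)).+1.
have /andP[mlo mhi] : (Num.truncn ((b + 2) / c))%:R <= (b + 2) / c < m%:R.
  by apply: truncn_itv; rewrite divr_ge0 // ?ltW //; lra.
have powD x y : 3 `^ (x + y) = 3 `^ x * 3 `^ y :> R.
  by rewrite powRD // pnatr_eq0 implybT.
have p3 k : (3 ^ k)%:R = 3 `^ k%:R :> R by rewrite natrX powR_mulrn.
have := cap_supersaturation m A.
rewrite -(ler_nat R) natrD !natrM !p3.
have -> : 3 `^ m%:R * #|A|%:R * 3 `^ n%:R = #|A|%:R * 3 `^ (m%:R + n%:R) :> R.
  by rewrite powD; ring.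
rewrite -!powD => h.
set X := 3 `^ (m%:R - b - 1 + 2 * n%:R) : R.
have X0 : 0 < X by apply: powR_gt0.
have h1 : 3 * X <= #|A|%:R * 3 `^ (m%:R + n%:R).
  apply: le_trans (ler_wpM2r (powR_ge0 _ _) hA).
  by rewrite -powD -[X in X * _](@powRr1 R) // -powD ler_powR; lra.
have h2 : 3 * #|low_exponents m|%:R * 3 `^ (n%:R + n%:R) <= X.
  have hL := low_exponents_le_gamma0 m.
  rewrite gammaE -powR_mulrn ?powR_ge0 // -powRrM in hL.
  apply: (@le_trans _ _ (3 * 3 `^ (l * m%:R) * 3 `^ (n%:R + n%:R))).
    by rewrite ler_wpM2r ?powR_ge0 // ler_wpM2l.
  rewrite -{1}[3](@powRr1 R) // -!powD ler_powR //; first lra.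
  by move: mhi; rewrite ltr_pdivrMr // /c; lra.
have h3 : X <= 3 `^ (m%:R + m%:R) * (line_count A)%:R by move: h h1 h2 X0; lra.
have h4 : X = 3 `^ (m%:R + m%:R) * 3 `^ (2 * n%:R - m%:R - b - 1).
  by rewrite -powD; congr (_ `^ _); ring.
rewrite h4 ler_pM2l ?powR_gt0 // in h3.
apply: le_trans h3; rewrite ler_powR //; first lra.
have -> : C0 R = 1 + c^-1 by rewrite /C0 mul1r.
by move: mlo; rewrite -[m%:R]natr1; lra.
Qed.

End CapSetConstant.

Unset Implicit Arguments.

Theorem theorem5p1 (R : realType) (q s t : nat) :
  (q = 2%N \/ q = 3%N) -> (2 <= s)%N -> (s <= t)%N ->
  vramsey_le [the fieldType of 'F_q] s t (tower s.-1 (sigmaq R q) (2 * t)%:R).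
Proof.
move=> hq s2 st; have t2 := leq_trans s2 st.
case: s s2 st => // s _ _ /=.
case: hq => ->; rewrite /sigmaq /=.
(* For [C = 2] and [K = 0] the equation for [k] gives 1, and [t + 2 <= 2^t] holds from [t = 2]
   on. *)
- have [||n [tn htow hn]] := @vramsey_tower R 'F_2 2 0 1 t (lexx _) (lexx _) (lexx _)
    _ _ (@supersaturated_F2 R) t2 s.
  + by ring.
  + have h : (t + 2 <= 2 ^ t)%N.
      by elim: t t2 => // [[|[|t]]] // IH _; rewrite expnS; have := IH isT; lia.
    by have := h; rewrite -(ler_nat R) natrD natrX; lra.
  + by exists n; split => //; apply: le_trans htow; rewrite lerDl.
- have C3 := C0_ge3 R.
  (* The solution of [C * k = K + 1 + k] for [K = 2 * C0]. Since [C0 >= 3] gives [k <= 4], the bound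
     [t + 5 <= 3^t] suffices. *)
  pose k := (2 * C0 R + 1) / (C0 R - 1).
  have kE : k * (C0 R - 1) = 2 * C0 R + 1 by rewrite divfK //; lra.
  have [|||||n [tn htow hn]] := @vramsey_tower R 'F_3 (C0 R) (2 * C0 R) k t
    _ _ _ _ _ (@supersaturated_F3 R) t2 s.
  + by lra.
  + by lra.
  + by nra.
  + by lra.
  + have h : (t + 5 <= 3 ^ t)%N.
      by elim: t t2 => // [[|[|t]]] // IH _; rewrite expnS; have := IH isT; lia.
    have h2 : 3 ^+ t <= C0 R ^+ t by rewrite lerXn2r // nnegrE; lra.
    have k4 : k <= 4 by nra.
    by have := h; rewrite -(ler_nat R) natrD natrX; lra.
  + by exists n; split => //; apply: le_trans htow; rewrite lerDl.
Qed.
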